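(* Let $\rho_1,\dots,\rho_n$ be $m$-qubit density operators and let $U_1,\dots,U_n$ be unitary operations on $m$ qubits. There exists a unitary operation $\chi$ consisting of two Hadamard gates, $n$ controlled-$U_j$ operations and $nm$ controlled swap gates such that for any state of the form $\rho_1\otimes\cdots\otimes\rho_n$, $$\mathrm{Tr}\left((|0\rangle\langle0|\otimes I)\,\chi\,\left(|0\rangle\langle 0|\otimes\rho_1\otimes\cdots\otimes\rho_n\right)\chi^\dagger\right)=\frac{1+\mathrm{Re}\left[\mathrm{Tr}\left(\prod_{i=1}^n U_i\rho_i\right)\right]}{2}.$$
   Context: The operation $\chi$ acts on one ancilla qubit (the first tensor factor) and $n$ registers of $m$ qubits each; the Hadamard gates act on the ancilla, which is the control qubit for the controlled operations. A controlled-$U_j$ operation applies $U_j$ to one of the $m$-qubit registers when the control is $|1\rangle$; a controlled swap gate exchanges two single qubits when the control is $|1\rangle$. $I$ is the identity on the $nm$ register qubits. The product is ordered: $\prod_{i=1}^nU_i\rho_i=U_1\rho_1U_2\rho_2\cdots U_n\rho_n$. A density operator is a positive semidefinite matrix of trace one. *)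

(* Defs.v *)
From mathcomp Require Export all_boot all_order all_algebra.
From mathcomp Require Export all_fingroup reals.
From mathcomp.real_closed Require Export complex mxtens.
Set Implicit Arguments.
Unset Strict Implicit.
Unset Printing Implicit Defensive.
Import GRing.Theory Num.Theory.
Local Open Scope ring_scope.

(* Dimension of the k-fold tensor power of a d-dimensional space. Its          *)
(* computational basis is indexed by the digit functions 'I_k -> 'I_d, via     *)
(* enum_val/enum_rank.                                                        *)
Definition tdim (d k : nat) : nat := #|{ffun 'I_k -> 'I_d}|.

Lemma tdimE (d k : nat) : tdim d k = (d ^ k)%N.
Proof. by rewrite /tdim card_ffun !card_ord. Qed.

Definition digit (d k : nat) (x : 'I_(tdim d k)) (i : 'I_k) : 'I_d :=
  (enum_val x : {ffun 'I_k -> 'I_d}) i.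

Definition qdim (m : nat) : nat := tdim 2 m.

Definition regdim (n m : nat) : nat := tdim (qdim m) n.

(* A register qubit (k, l) is the l-th qubit of the k-th register. *)
Definition qubit (n m : nat) : finType := ('I_n * 'I_m)%type.

Definition bit (n m : nat) (x : 'I_(regdim n m)) (q : qubit n m) : 'I_2 :=
  digit (digit x q.1) q.2.

Inductive gate (n m : nat) : Type :=
| Hadamard
  (* controlled-U_j with the k-th register as target *)
| CtrlU (j k : 'I_n)
| CtrlSwap (p q : qubit n m).

Arguments Hadamard {n m}.
Arguments CtrlU {n m} j k.
Arguments CtrlSwap {n m} p q.

(* Gates are listed in the order in which they are applied. *)
Definition circuit (n m : nat) : Type := seq (gate n m).

Definition hadamards (n m : nat) (c : circuit n m) : nat :=
  count (fun g => if g is Hadamard then true else false) c.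

Definition ctrlU_labels (n m : nat) (c : circuit n m) : seq 'I_n :=
  pmap (fun g => if g is CtrlU j _ then Some j else None) c.

Definition ctrlSwap_targets (n m : nat) (c : circuit n m) :
    seq (qubit n m * qubit n m) :=
  pmap (fun g => if g is CtrlSwap p q then Some (p, q) else None) c.

(* The two targets of a swap must be distinct. The single exception is        *)
(* n = m = 1, where there is only one register qubit, so that the one swap    *)
(* gate called for can only be the degenerate one.                            *)
Definition has_gate_counts (n m : nat) (c : circuit n m) : Prop :=
  [/\ hadamards c = 2%N,
      perm_eq (ctrlU_labels c) (enum 'I_n),
      size (ctrlSwap_targets c) = (n * m)%N
    & (n * m != 1)%N -> all (fun pq => pq.1 != pq.2) (ctrlSwap_targets c)].

Section Operators.
Variable C : numClosedFieldType.

Definition adjmx (a b : nat) (A : 'M[C]_(a, b)) : 'M[C]_(b, a) :=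
  map_mx Num.conj A^T.

Definition psdmx (d : nat) (A : 'M[C]_d) : Prop :=
  A = adjmx A /\ forall v : 'cV[C]_d, 0 <= (adjmx v *m A *m v) 0 0.

Definition density (d : nat) (A : 'M[C]_d) : Prop := psdmx A /\ \tr A = 1.

Definition tensor (d k : nat) (A : 'I_k -> 'M[C]_d) : 'M[C]_(tdim d k) :=
  \matrix_(x, y) \prod_(i < k) A i (digit x i) (digit y i).

(* |b><b| on one qubit *)
Definition proj_qubit (b : 'I_2) : 'M[C]_2 := delta_mx b b.

Definition hadamard_mx : 'M[C]_2 :=
  (sqrtC 2)^-1 *: \matrix_(a, b) (-1) ^+ (a * b).

Definition on_register (n m : nat) (k : 'I_n) (V : 'M[C]_(qdim m)) :
    'M[C]_(regdim n m) :=
  tensor (fun i => if i == k then V else 1%:M).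

Definition swap_mx (n m : nat) (p q : qubit n m) : 'M[C]_(regdim n m) :=
  \matrix_(x, y) [forall r, bit x r == bit y (tperm p q r)]%:R.

Definition controlled (d : nat) (V : 'M[C]_d) : 'M[C]_(2 * d) :=
  proj_qubit 0 *t 1%:M + proj_qubit 1 *t V.

Definition gate_mx (n m : nat) (U : 'I_n -> 'M[C]_(qdim m)) (g : gate n m) :
    'M[C]_(2 * regdim n m) :=
  match g with
  | Hadamard => hadamard_mx *t 1%:M
  | CtrlU j k => controlled (on_register k (U j))
  | CtrlSwap p q => controlled (swap_mx p q)
  end.

(* The first gate applied is the rightmost factor. *)
Definition circuit_mx (n m : nat) (U : 'I_n -> 'M[C]_(qdim m))
    (c : circuit n m) : 'M[C]_(2 * regdim n m) :=
  \prod_(g <- rev c) gate_mx U g.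

Definition composed_of (n m : nat) (U : 'I_n -> 'M[C]_(qdim m))
    (chi : 'M[C]_(2 * regdim n m)) : Prop :=
  exists c : circuit n m, has_gate_counts c /\ chi = circuit_mx U c.

End Operators.

(* Main.v *)
(* With [K = |0><0| (x) 1 + |1><1| (x) V] sandwiched between two Hadamards, the
   |0>-to-|0> block of the circuit is [(1 + V) / 2]; for [V] unitary and [rho]
   Hermitian of trace one this gives the probability [(1 + Re Tr (V rho)) / 2].
   Take [V = P (U_1 (x) ... (x) U_n)] with [P] the cyclic shift of the registers:
   expanding both traces over closed index paths gives
   [Tr (P (A_1 (x) ... (x) A_n)) = Tr (A_1 ... A_n)].
   The shift is a product of the [n - 1] register transpositions [(0 k)], that is
   of [(n - 1) m] qubit swaps; the remaining [m] swaps are performed before the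
   first Hadamard, where the control is |0> and they do nothing. *)
Require Import Defs.
From mathcomp Require Import all_boot all_order all_algebra reals.
From mathcomp.real_closed Require Import complex mxtens.
From mathcomp Require Import ring.
Import GRing.Theory Num.Theory.
Local Open Scope ring_scope.

(** * Adjoints, tensor products and one-qubit operators *)

Section Adjoint.
Variable C : numClosedFieldType.

Lemma adjmxM a b c (A : 'M[C]_(a, b)) (B : 'M[C]_(b, c)) :
  adjmx (A *m B) = adjmx B *m adjmx A.
Proof. by rewrite /adjmx trmx_mul map_mxM. Qed.

Lemma adjmxD a b (A B : 'M[C]_(a, b)) : adjmx (A + B) = adjmx A + adjmx B.
Proof. by rewrite /adjmx linearD /= map_mxD. Qed.

Lemma adjmxZ a b (c : C) (A : 'M[C]_(a, b)) : adjmx (c *: A) = c^* *: adjmx A.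
Proof. by rewrite /adjmx linearZ /= map_mxZ. Qed.

Lemma adjmx1 d : adjmx 1%:M = 1%:M :> 'M[C]_d.
Proof. by rewrite /adjmx trmx1 map_mx1. Qed.

Lemma adjmx_tens a b c d (A : 'M[C]_(a, b)) (B : 'M[C]_(c, d)) :
  adjmx (A *t B) = adjmx A *t adjmx B.
Proof. by rewrite /adjmx trmx_tens map_mxT. Qed.

Lemma mxtrace_adj d (A : 'M[C]_d) : \tr (adjmx A) = (\tr A)^*.
Proof. by rewrite /adjmx trace_map_mx mxtrace_tr. Qed.

Lemma unitarymx_adjP d (A : 'M[C]_d) :
  reflect (A *m adjmx A = 1%:M) (A \is unitarymx).
Proof. exact: unitarymxP. Qed.

Lemma mxtrace_tens a b (A : 'M[C]_a) (B : 'M[C]_b) :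
  \tr (A *t B) = \tr A * \tr B.
Proof. by rewrite /mxtrace mulr_sum; apply: eq_bigr => i _; rewrite mxE. Qed.

Lemma tensmx11 a b : (1%:M : 'M[C]_a) *t (1%:M : 'M[C]_b) = 1%:M.
Proof.
apply/matrixP=> i j; case: (mxtens_indexP i)=> i0 i1.
case: (mxtens_indexP j)=> j0 j1; rewrite tensmxE !mxE -natrM mulnb.
by rewrite (can_eq (@mxtens_indexK _ _)).
Qed.

Lemma tensmxDr a b c d (A : 'M[C]_(a, b)) (B B' : 'M[C]_(c, d)) :
  A *t (B + B') = A *t B + A *t B'.
Proof. by apply/matrixP=> i j; rewrite !mxE mulrDr. Qed.

Lemma tensmxZl a b c d (k : C) (A : 'M[C]_(a, b)) (B : 'M[C]_(c, d)) :
  (k *: A) *t B = k *: (A *t B).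
Proof. by apply/matrixP=> i j; rewrite !mxE mulrA. Qed.

Lemma tensmxZr a b c d (k : C) (A : 'M[C]_(a, b)) (B : 'M[C]_(c, d)) :
  A *t (k *: B) = k *: (A *t B).
Proof. by apply/matrixP=> i j; rewrite !mxE mulrCA. Qed.

Lemma adjmx_proj b : adjmx (proj_qubit C b) = proj_qubit C b.
Proof. by apply/matrixP=> i j; rewrite !mxE rmorph_nat andbC. Qed.

Lemma mul_proj a b :
  proj_qubit C a *m proj_qubit C b = if a == b then proj_qubit C a else 0.
Proof.
case: eqP => [<-|/eqP ab]; first by rewrite /proj_qubit mul_delta_mx.
by rewrite /proj_qubit mul_delta_mx_0.
Qed.

Lemma proj_sum : proj_qubit C 0 + proj_qubit C 1 = 1%:M.
Proof.
by apply/matrixP=> i j; rewrite !mxE; case: i j => [[|[]]//?] [[|[]]//?];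
  rewrite /= ?addr0 ?add0r.
Qed.

Lemma hadamard_mxE a b :
  hadamard_mx C a b = (sqrtC 2)^-1 * (-1) ^+ (a * b)%N.
Proof. by rewrite !mxE. Qed.

Lemma sqrtC2V_sqr : (sqrtC 2)^-1 * (sqrtC 2)^-1 = 2^-1 :> C.
Proof. by rewrite -invfM -expr2 sqrtCK. Qed.

Lemma adjmx_hadamard : adjmx (hadamard_mx C) = hadamard_mx C.
Proof.
apply/matrixP=> i j; rewrite [LHS]mxE mxE !hadamard_mxE mulnC.
by rewrite rmorphM rmorphXn rmorphN1 fmorphV /= geC0_conj ?sqrtC_ge0.
Qed.

Lemma hadamard_mx_sqr : hadamard_mx C *m hadamard_mx C = 1%:M.
Proof.
apply/matrixP=> i j; rewrite mxE !big_ord_recr big_ord0 /= add0r !hadamard_mxE.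
rewrite [X in X + _]mulrACA [X in _ + X]mulrACA sqrtC2V_sqr !mxE -mulrDr /=.
have half2 : 2^-1 * (1 + 1) = 1 :> C by rewrite -[1 + 1]/(2%:R) mulVf ?pnatr_eq0.
by case: i j => [[|[]]//?] [[|[]]//?]; rewrite /= ?expr0 ?expr1 ?mulr1 ?mulrNN
  ?mul1r ?subrr ?mulr0 ?mulr1.
Qed.

Lemma hadamard_unitary d : hadamard_mx C *t (1%:M : 'M[C]_d) \is unitarymx.
Proof.
apply/unitarymx_adjP.
by rewrite adjmx_tens adjmx1 adjmx_hadamard tensmx_mul hadamard_mx_sqr mulmx1
  tensmx11.
Qed.

Lemma delta_mx_conj d (i j : 'I_d) (M : 'M[C]_d) :
  delta_mx i i *m M *m delta_mx j j = M i j *: delta_mx i j.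
Proof.
apply/matrixP=> a b; rewrite !mxE (bigD1 j) //= big1 => [|k /negPf kj]; last first.
  by rewrite !mxE kj mulr0.
rewrite !mxE (bigD1 i) //= big1 => [|k /negPf ki]; last first.
  by rewrite !mxE ki andbF mul0r.
by rewrite !mxE !eqxx !addr0 andbT mulrAC -natrM mulnb mulrC.
Qed.

(** Row 0 and column 0 of the Hadamard matrix carry no sign, so both values of [b] contribute the
    same square of [1 / sqrt 2]. *)
Lemma hadamard_proj (b : 'I_2) :
  proj_qubit C 0 *m (hadamard_mx C *m proj_qubit C b *m hadamard_mx C)
    *m proj_qubit C 0 = 2^-1 *: proj_qubit C 0.
Proof.
rewrite delta_mx_conj; congr (_ *: _).
rewrite mxE (bigD1 b) //= big1 => [|k /negPf kb]; last first.
  rewrite mxE big1 ?mul0r // => l _.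
  by rewrite [X in _ * X]mxE kb andbF mulr0.
rewrite mxE (bigD1 b) //= big1 => [|k /negPf kb]; last first.
  by rewrite [X in _ * X]mxE kb mulr0.
rewrite [delta_mx b b _ _]mxE !hadamard_mxE eqxx mul0n muln0 !expr0 !mulr1 !addr0.
exact: sqrtC2V_sqr.
Qed.

(** * Controlled operators and the Hadamard test *)

Section Controlled.
Variable d : nat.
Implicit Types V W X : 'M[C]_d.

Lemma adjmx_controlled V : adjmx (controlled V) = controlled (adjmx V).
Proof. by rewrite /controlled adjmxD !adjmx_tens !adjmx_proj adjmx1. Qed.

Lemma controlledM V W : controlled V *m controlled W = controlled (V *m W).
Proof.
rewrite /controlled mulmxDl !mulmxDr !tensmx_mul !mul_proj /= !tens0mx mulmx1.
by rewrite addr0 add0r.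
Qed.

Lemma controlled1 : controlled 1%:M = 1%:M :> 'M[C]_(2 * d).
Proof.
rewrite /controlled -tensmx11 -proj_sum.
by apply/matrixP=> i j; rewrite !mxE mulrDl.
Qed.

Lemma controlled_unitary V : V \is unitarymx -> controlled V \is unitarymx.
Proof.
move=> /unitarymx_adjP VV; apply/unitarymx_adjP.
by rewrite adjmx_controlled controlledM VV controlled1.
Qed.

(** An ancilla in state |0> selects the identity branch; this is why padding swaps are harmless. *)
Lemma controlled_proj0 W X :
  controlled W *m (proj_qubit C 0 *t X) = proj_qubit C 0 *t X.
Proof.
by rewrite /controlled mulmxDl !tensmx_mul !mul_proj /= tens0mx addr0 mul1mx.
Qed.

Lemma proj0_hadamard_test V W :
  (proj_qubit C 0 *t 1%:M)
    *m ((hadamard_mx C *t 1%:M) *m controlled V *m (hadamard_mx C *t 1%:M)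
          *m controlled W)
    *m (proj_qubit C 0 *t 1%:M)
  = proj_qubit C 0 *t (2^-1 *: (1%:M + V)).
Proof.
rewrite -!mulmxA controlled_proj0 !mulmxA /controlled !(mulmxDr, mulmxDl).
rewrite !tensmx_mul !(mul1mx, mulmx1).
have HP b : proj_qubit C 0 *m hadamard_mx C *m proj_qubit C b *m hadamard_mx C
    *m proj_qubit C 0 = 2^-1 *: proj_qubit C 0.
  by rewrite -(hadamard_proj b) !mulmxA.
rewrite !HP.
by rewrite !tensmxZl -scalerDr -tensmxDr tensmxZr.
Qed.

(** The input and the measurement both project the ancilla on |0>, so only the block [(1 + V) / 2]
    of [chi] matters; the block and its adjoint each give a factor 1/2. *)
Lemma hadamard_test V W X (chi := (hadamard_mx C *t 1%:M) *m controlled V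
    *m (hadamard_mx C *t 1%:M) *m controlled W) :
  \tr ((proj_qubit C 0 *t 1%:M) *m chi *m (proj_qubit C 0 *t X) *m adjmx chi)
  = 4^-1 * \tr ((1%:M + V) *m X *m adjmx (1%:M + V)).
Proof.
set Q := proj_qubit C 0 *t 1%:M.
have QQ : Q *m Q = Q by rewrite tensmx_mul mul_proj eqxx mulmx1.
have QXQ : proj_qubit C 0 *t X = Q *m (1%:M *t X) *m Q.
  by rewrite !tensmx_mul !(mul1mx, mulmx1) mul_proj.
have Qadj : adjmx Q = Q by rewrite adjmx_tens adjmx_proj adjmx1.
have := proj0_hadamard_test V W; rewrite -/Q -/chi => E.
(* The leading projection is doubled, and cyclicity of the trace carries one copy behind
   [adjmx chi]. *)
transitivity (\tr (Q *m chi *m Q *m (1%:M *t X) *m adjmx (Q *m chi *m Q))).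
  by rewrite !adjmxM Qadj QXQ -{1}QQ -!mulmxA [LHS]mxtrace_mulC !mulmxA.
rewrite E adjmx_tens adjmx_proj !tensmx_mul mulmx1 mul_proj eqxx mxtrace_tens.
rewrite /proj_qubit -[\tr (delta_mx _ _)]/(\sum_i _) big_ord_recr big_ord1 /= !mxE.
rewrite addr0 mul1r adjmxZ -!scalemxAl -scalemxAr scalerA mxtraceZ.
by rewrite fmorphV rmorph_nat -invfM -natrM.
Qed.

(** Of the four terms of the expansion, two have trace 1; the two cross terms have conjugate traces,
    because [X] is Hermitian, and add up to twice the real part. *)
Lemma hadamard_test_density V W X (chi := (hadamard_mx C *t 1%:M) *m controlled V
    *m (hadamard_mx C *t 1%:M) *m controlled W) :
  V \is unitarymx -> adjmx X = X -> \tr X = 1 ->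
  \tr ((proj_qubit C 0 *t 1%:M) *m chi *m (proj_qubit C 0 *t X) *m adjmx chi)
  = (1 + 'Re (\tr (V *m X))) / 2.
Proof.
move=> /unitarymx_adjP VV XX X1; rewrite hadamard_test adjmxD adjmx1.
rewrite mulmxDr mulmx1 !mulmxDl mul1mx !mxtraceD.
have -> : \tr (V *m X *m adjmx V) = 1.
  by rewrite -mulmxA mxtrace_mulC -mulmxA (mulmx1C VV) mulmx1.
have -> : \tr (X *m adjmx V) = (\tr (V *m X))^*.
  by rewrite -mxtrace_adj adjmxM XX.
by rewrite X1 ReE; field.
Qed.
End Controlled.
End Adjoint.

(** * Tensor powers in the digit basis *)

Section Digits.
Variables d k : nat.
Implicit Types x y : 'I_(tdim d k).

Definition of_digits (f : 'I_k -> 'I_d) : 'I_(tdim d k) :=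
  enum_rank [ffun i => f i].

Lemma digit_of_digits f i : digit (of_digits f) i = f i.
Proof. by rewrite /digit enum_rankK ffunE. Qed.

Lemma digit_inj x y : digit x =1 digit y -> x = y.
Proof. by move=> xy; apply: enum_val_inj; apply/ffunP=> i; apply: xy. Qed.

(** Sums over functions are what distributing a product of sums produces, so sums over basis indices
    are brought to this form. *)
Lemma sum_digits (R : nmodType) (F : {ffun 'I_k -> 'I_d} -> R) :
  \sum_(x : 'I_(tdim d k)) F (enum_val x) = \sum_f F f.
Proof.
rewrite [RHS](reindex (fun x : 'I_(tdim d k) => enum_val x)) //=.
by apply: onW_bij; exists enum_rank; [apply: enum_valK | apply: enum_rankK].
Qed.

Variable C : numClosedFieldType.
Implicit Types A B : 'I_k -> 'M[C]_d.

Lemma eq_tensor A B : A =1 B -> tensor A = tensor B.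
Proof.
move=> AB; apply/matrixP=> x y; rewrite !mxE.
by apply: eq_bigr => i _; rewrite AB.
Qed.

Lemma tensorM A B : tensor A *m tensor B = tensor (fun i => A i *m B i).
Proof.
apply/matrixP=> x y; rewrite !mxE.
under eq_bigr do rewrite !mxE -big_split /=.
under [RHS]eq_bigr do rewrite mxE.
rewrite (sum_digits _ (fun f : {ffun 'I_k -> 'I_d} =>
  \prod_(i < k) (A i (digit x i) (f i) * B i (f i) (digit y i)))).
by rewrite bigA_distr_bigA.
Qed.

Lemma tensor1 : tensor (fun=> 1%:M : 'M[C]_d) = 1%:M :> 'M_(tdim d k).
Proof.
apply/matrixP=> x y; rewrite !mxE; case: eqP => [->|xy].
  by rewrite big1 // => i _; rewrite mxE eqxx.
case: (pickP (fun i => digit x i != digit y i)) => [i xyi|xy0].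
  by rewrite (bigD1 i) //= mxE (negPf xyi) mul0r.
by case: xy; apply: digit_inj => i; apply/eqP/negbFE/xy0.
Qed.

Lemma tensor_prod (I : Type) (s : seq I) (F : I -> 'I_k -> 'M[C]_d) :
  \prod_(j <- s) tensor (F j) = tensor (fun i => \prod_(j <- s) F j i).
Proof.
elim: s => [|j s IHs].
  rewrite big_nil; transitivity (tensor (fun i : 'I_k => 1%:M : 'M[C]_d)).
    by rewrite tensor1.
  by apply: eq_tensor => i; rewrite big_nil.
rewrite big_cons IHs -mulmxE tensorM; apply: eq_tensor => i.
by rewrite big_cons.
Qed.

Lemma adjmx_tensor A : adjmx (tensor A) = tensor (fun i => adjmx (A i)).
Proof.
apply/matrixP=> x y; rewrite !mxE rmorph_prod.
by apply: eq_bigr => i _; rewrite !mxE.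
Qed.

Lemma mxtrace_tensor A : \tr (tensor A) = \prod_i \tr (A i).
Proof.
rewrite /mxtrace; under [LHS]eq_bigr do rewrite mxE.
rewrite (sum_digits _ (fun f : {ffun 'I_k -> 'I_d} => \prod_i A i (f i) (f i))).
by rewrite bigA_distr_bigA.
Qed.

Lemma tensor_unitary A : (forall i, A i \is unitarymx) -> tensor A \is unitarymx.
Proof.
move=> AU; apply/unitarymx_adjP; rewrite adjmx_tensor tensorM -tensor1.
by apply: eq_tensor => i; apply/unitarymx_adjP.
Qed.

End Digits.

Arguments of_digits {d k} f.

(** * Traces of products as sums over closed index paths *)

Section PathSum.
Variables (C : numClosedFieldType) (d : nat).

(** The function under [F] starts with [c] and continues as [f]; each path arises once in this way,
    which allows induction on its length. *)
Lemma sum_ffunS (R : nmodType) n (F : {ffun 'I_n.+1 -> 'I_d} -> R) :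
  \sum_f F f = \sum_(c < d) \sum_(f : {ffun 'I_n -> 'I_d})
    F [ffun i => oapp f c (unlift ord0 i)].
Proof.
rewrite pair_big /= (reindex (fun p : 'I_d * {ffun 'I_n -> 'I_d} =>
  [ffun i => oapp p.2 p.1 (unlift ord0 i)])) //=.
apply: onW_bij.
exists (fun f : {ffun 'I_n.+1 -> 'I_d} => (f ord0, [ffun i => f (lift ord0 i)])).
  case=> c f; rewrite /= ffunE unlift_none /=; congr (_, _).
  by apply/ffunP=> i; rewrite !ffunE liftK.
move=> f; apply/ffunP=> i; rewrite ffunE /=.
by case: unliftP => [j|] ->; rewrite /= ?ffunE.
Qed.

(* The index [oapp f b (insub i.+1)] is [f (i + 1)], or [b] when [i] is last. *)
Lemma prod_mx_path n (A : 'I_n.+1 -> 'M[C]_d) a b :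
  (\prod_(i < n.+1) A i) a b =
  \sum_(f : {ffun 'I_n.+1 -> 'I_d} | f ord0 == a)
     \prod_(i < n.+1) A i (f i) (oapp f b (insub i.+1)).
Proof.
elim: n A a b => [|n IHn] A a b; rewrite [RHS]big_mkcond [RHS]sum_ffunS.
  rewrite big_ord1 (bigD1 a) //= [X in _ + X]big1 ?addr0 => [|c ca]; last first.
    by apply: big1 => f _; rewrite ffunE unlift_none /= (negPf ca).
  rewrite (big_pred1 [ffun i : 'I_0 => a]) => [|f]; last first.
    by apply/esym/eqP/ffunP; case.
  by rewrite big_ord1 !ffunE !unlift_none /= eqxx insubF.
rewrite big_ord_recl -mulmxE mxE; under eq_bigr do rewrite IHn big_distrr /=.
rewrite (exchange_big_dep xpredT) //= (bigD1 a) //=.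
rewrite [X in _ + X]big1 ?addr0 => [|c ca].
  (* The intermediate index of the matrix product is forced to be the first index of the tail
     [f]. *)
  apply: eq_bigr => f _; rewrite ffunE unlift_none eqxx (big_pred1 (f ord0)).
    rewrite [RHS]big_ord_recl; congr (_ * _).
      rewrite ffunE unlift_none insubT //= ffunE.
      by rewrite (_ : Sub _ _ = lift ord0 ord0) ?liftK //; apply: val_inj.
    apply: eq_bigr => i _; rewrite ffunE liftK /=; congr (A _ _ _).
    rewrite /bump /= add1n.
    (* Position [i] of the tail is position [i + 1] of the whole path: either both have a successor
       or both fall back on [b]. *)
    case: (ltnP i.+1 n.+1) => lt_in; last first.
      by rewrite !insubF //; apply/negbTE; rewrite -leqNgt.
    rewrite !insubT //= ffunE (_ : Sub _ _ = lift ord0 (Sub i.+1 lt_in)) ?liftK //.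
    exact: val_inj.
  by move=> c; rewrite eq_sym.
by apply: big1 => f _; rewrite ffunE unlift_none /= (negPf ca).
Qed.

(** On the diagonal the end index equals the start [f ord0], so the default after the last position
    becomes the wrap-around of [ordS]. *)
Lemma mxtrace_prod_cycle n (A : 'I_n.+1 -> 'M[C]_d) :
  \tr (\prod_(i < n.+1) A i) =
  \sum_(f : {ffun 'I_n.+1 -> 'I_d}) \prod_(i < n.+1) A i (f i) (f (ordS i)).
Proof.
rewrite /mxtrace; under [LHS]eq_bigr do rewrite prod_mx_path.
rewrite (exchange_big_dep xpredT) //=; apply: eq_bigr => f _.
rewrite (big_pred1 (f ord0)) => [|a]; last by rewrite eq_sym.
apply: eq_bigr => i _; congr (A i _ _).
case: (ltnP i.+1 n.+1) => lt_in.
  by rewrite insubT /=; congr (f _); apply: val_inj; rewrite /= modn_small.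
rewrite insubF /=; last by rewrite ltnNge lt_in.
congr (f _); apply: val_inj => /=.
have -> : i.+1 = n.+1 by apply/eqP; rewrite eqn_leq ltn_ord.
by rewrite modnn.
Qed.

End PathSum.

(** * Qubit permutations as unitary matrices *)

Section QubitPermutations.
Variables (C : numClosedFieldType) (n m : nat).
Implicit Types (s t : {perm qubit n m}) (x y : 'I_(regdim n m)).

Definition qperm s y : 'I_(regdim n m) :=
  of_digits (fun k => of_digits (fun l => bit y (s (k, l)))).

Lemma bit_qperm s y q : bit (qperm s y) q = bit y (s q).
Proof. by rewrite /bit /qperm !digit_of_digits; case: q. Qed.

Lemma bit_inj x y : bit x =1 bit y -> x = y.
Proof.
by move=> xy; apply: digit_inj => k; apply: digit_inj => l; apply: (xy (k, l)).
Qed.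

(** Relabelling bits reverses composition, and so does the product of permutations, whose left
    factor acts first; hence the order of the factors is kept. *)
Lemma qpermM s t y : qperm s (qperm t y) = qperm (s * t)%g y.
Proof. by apply: bit_inj => q; rewrite !bit_qperm permM. Qed.

Lemma qperm1 y : qperm 1%g y = y.
Proof. by apply: bit_inj => q; rewrite bit_qperm perm1. Qed.

Definition qperm_mx s : 'M[C]_(regdim n m) :=
  \matrix_(x, y) (x == qperm s y)%:R.

Lemma swap_mxE p q : swap_mx C p q = qperm_mx (tperm p q).
Proof.
apply/matrixP=> x y; rewrite !mxE; congr (_%:R); congr nat_of_bool.
apply/forallP/eqP => [xy|-> r]; last by rewrite bit_qperm.
by apply: bit_inj => r; rewrite bit_qperm; apply/eqP.
Qed.

Lemma qperm_mxM s t : qperm_mx s *m qperm_mx t = qperm_mx (s * t).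
Proof.
apply/matrixP=> x z; rewrite !mxE (bigD1 (qperm t z)) //= big1 => [|y yz].
  by rewrite !mxE eqxx mulr1 addr0 qpermM.
by rewrite !mxE (negPf yz) mulr0.
Qed.

Lemma qperm_mx1 : qperm_mx 1 = 1%:M.
Proof. by apply/matrixP=> x y; rewrite !mxE qperm1. Qed.

Lemma adjmx_qperm s : adjmx (qperm_mx s) = qperm_mx s^-1.
Proof.
apply/matrixP=> x y; rewrite !mxE rmorph_nat.
by congr ((nat_of_bool _)%:R); apply/eqP/eqP => ->;
  rewrite qpermM ?mulgV ?mulVg qperm1.
Qed.

Lemma qperm_unitary s : qperm_mx s \is unitarymx.
Proof.
by apply/unitarymx_adjP; rewrite adjmx_qperm qperm_mxM mulgV qperm_mx1.
Qed.

Lemma prod_controlled_swap (r : seq (qubit n m * qubit n m)) :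
  \prod_(pq <- r) controlled (swap_mx C pq.1 pq.2)
  = controlled (qperm_mx (\prod_(pq <- r) tperm pq.1 pq.2)%g).
Proof.
elim: r => [|pq r IHr]; first by rewrite !big_nil qperm_mx1 controlled1.
by rewrite !big_cons IHr swap_mxE -mulmxE controlledM qperm_mxM.
Qed.

End QubitPermutations.

Arguments qperm {n m} s y.
Arguments qperm_mx C {n m} s.

(** * The cyclic shift of the registers: trace formula and factorization into swaps *)

(** The permutation matrix pairs each row [x] with the one column whose digits are those of [x]
    shifted by one, which leaves exactly the closed-path products. *)
Lemma mxtrace_qperm_shift (C : numClosedFieldType) n m
    (s : {perm qubit n.+1 m}) (A : 'I_n.+1 -> 'M[C]_(qdim m)) :
  (forall k l, s (k, l) = (ordS k, l)) ->
  \tr (qperm_mx C s *m tensor A) = \tr (\prod_(i < n.+1) A i).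
Proof.
move=> sE; rewrite mxtrace_prod_cycle mxtrace_mulC -sum_digits.
apply: eq_bigr => x _; rewrite !mxE (bigD1 (qperm s x)) //= big1 => [|y yx].
  rewrite !mxE eqxx mulr1 addr0; apply: eq_bigr => i _; congr (A i _ _).
  by apply: digit_inj => l; rewrite !digit_of_digits sE.
by rewrite !mxE (negPf yx) mulr0.
Qed.

(** A swap at qubit [c] moves only pairs with second coordinate [c], and no [c] recurs, so each pair
    meets at most one swap that can move it. *)
Lemma prod_tperm_layer n m (a b : 'I_n) (r : seq 'I_m) k l : uniq r ->
  (\prod_(c <- r) tperm (a, c) (b, c))%g (k, l)
  = ((if l \in r then tperm a b k else k), l).
Proof.
elim: r k => [|c r IHr] k /=; first by rewrite big_nil perm1.
case/andP=> cr /IHr {}IHr; rewrite big_cons permM in_cons.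
case: eqP cr => [<- /negPf lr|lc _] /=.
  have pair_inj : injective (fun x : 'I_n => (x, l)) by move=> x y [].
  by rewrite -(inj_tperm _ _ _ pair_inj) IHr lr.
have /negPf cl : c != l by apply/eqP=> cl; case: lc.
by rewrite tpermD ?IHr // xpair_eqE cl andbF.
Qed.

(** With left factors acting first, a point [a > 0] rests until [(0 a)] sends it to 0; the next
    factor, if any, sends it on to [a + 1], where it stays. *)
Lemma prod_tperm_star n (a : 'I_n.+1) :
  (\prod_(k < n) tperm ord0 (lift ord0 k))%g a = ordS a.
Proof.
have lift_inord (k : 'I_n) : lift ord0 k = inord k.+1.
  by apply: val_inj; rewrite /= /bump inordK // ltnS.
under eq_bigr do rewrite lift_inord.
rewrite -(big_mkord xpredT (fun k => tperm ord0 (inord k.+1))).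
(* Invariant after [j] factors: points below [j] have reached their successor, [j] is at 0, and
   points above [j] have not moved. *)
have star j : (j <= n)%N ->
    (\prod_(0 <= k < j) tperm ord0 (inord k.+1 : 'I_n.+1))%g a =
    (if a < j then a.+1 else if a == j :> nat then 0 else a)%N :> nat.
  elim: j => [|j IHj] lt_jn.
    by rewrite big_geq // perm1 /=; case: eqP.
  rewrite big_nat_recr //= permM; have {IHj} := IHj (ltnW lt_jn).
  set z := fun_of_perm _ a => Ez; have Ej : (inord j.+1 : 'I_n.+1) = j.+1 :> nat.
    by rewrite inordK.
  case: tpermP => [z0|zj|/eqP z0 /eqP zj]; move: Ez.
  - rewrite z0 Ej /=; case: (ltngtP a j) => [//|lt_ja a0|-> _].
      by rewrite -a0 in lt_ja.
    by rewrite ltnSn.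
  - rewrite zj Ej /=; case: (ltngtP a j) => [lt_aj [ja]|_ <-|_ //].
      by rewrite ja ltnn in lt_aj.
    by rewrite ltnn eqxx.
  - move: z0 zj; rewrite -val_eqE /= => z0; rewrite -val_eqE /= Ej => zj.
    case: (ltngtP a j) => [lt_aj|lt_ja|_] Ez.
    + by rewrite ltnS ltnW.
    + by rewrite ltnS leqNgt lt_ja /= -Ez (negPf zj).
    + by rewrite Ez in z0.
apply: val_inj; rewrite [LHS]star //=; case: (ltnP a n) => [lt_an|le_na].
  by rewrite modn_small ?ltnS.
have -> : (a : nat) = n by apply/eqP; rewrite eqn_leq le_na -ltnS ltn_ord.
by rewrite eqxx modnn.
Qed.

(** The outer index is the register: each group of [m] swaps exchanges register 0 with another one,
    in the order of the star factorization. *)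
Definition shift_swaps n m : seq (qubit n.+1 m * qubit n.+1 m) :=
  [seq ((ord0, l), (lift ord0 k, l)) | k <- enum 'I_n, l <- enum 'I_m].

Lemma size_shift_swaps n m : size (shift_swaps n m) = (n * m)%N.
Proof. by rewrite size_allpairs -!cardE !card_ord. Qed.

Lemma shift_swaps_neq n m :
  all (fun pq => pq.1 != pq.2) (shift_swaps n m).
Proof.
by apply/allP=> pq /allpairsP [[k l] [_ _ ->]].
Qed.

Lemma prod_shift_swaps n m k l :
  (\prod_(pq <- shift_swaps n m) tperm pq.1 pq.2)%g (k, l) = (ordS k, l).
Proof.
rewrite big_allpairs_dep /= -prod_tperm_star -[index_enum _]enumT.
elim: (enum 'I_n) k => [|a r IHr] k; first by rewrite !big_nil !perm1.
by rewrite !big_cons !permM prod_tperm_layer ?enum_uniq // mem_enum IHr.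
Qed.

(** * The circuit, its matrix and its gate counts *)

Section Circuit.
Variables (C : numClosedFieldType) (n m : nat).
Variable U : 'I_n -> 'M[C]_(qdim m).

Lemma circuit_mx_cat (c c' : circuit n m) :
  circuit_mx U (c ++ c') = circuit_mx U c' *m circuit_mx U c.
Proof. by rewrite /circuit_mx rev_cat big_cat mulmxE. Qed.

Lemma circuit_mx1 (g : gate n m) : circuit_mx U [:: g] = gate_mx U g.
Proof. by rewrite /circuit_mx big_seq1. Qed.

Definition swap_gates (s : seq (qubit n m * qubit n m)) : circuit n m :=
  [seq CtrlSwap pq.1 pq.2 | pq <- s].

Definition ctrlU_gates : circuit n m := [seq CtrlU j j | j <- enum 'I_n].

Lemma circuit_mx_swaps s :
  circuit_mx U (swap_gates s)
  = controlled (qperm_mx C (\prod_(pq <- rev s) tperm pq.1 pq.2)%g).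
Proof. by rewrite /circuit_mx -map_rev big_map prod_controlled_swap. Qed.

(** On register [i] every factor except the one labelled [i] is the identity, and that label occurs
    once. *)
Lemma circuit_mx_ctrlU :
  circuit_mx U ctrlU_gates = controlled (tensor U).
Proof.
rewrite /circuit_mx -map_rev big_map /=.
transitivity (controlled (\prod_(j <- rev (enum 'I_n)) on_register j (U j))).
  elim: (rev _) => [|j r IHr]; first by rewrite !big_nil controlled1.
  by rewrite !big_cons IHr -!mulmxE controlledM.
rewrite tensor_prod; congr controlled; apply: eq_tensor => i.
have: uniq (rev (enum 'I_n)) by rewrite rev_uniq enum_uniq.
have: i \in rev (enum 'I_n) by rewrite mem_rev mem_enum.
elim: (rev _) => // j r IHr; rewrite in_cons big_cons /=.
case: eqP => [<- _ /andP [ir _]|_ /= ir /andP [_ r_uniq]]; last first.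
  by rewrite IHr // mul1r.
rewrite big1_seq ?mulr1 // => k /= kr.
by case: eqP => // ik; rewrite ik kr in ir.
Qed.

(* Controlled gates applied while the control is |0> have no effect, so [W] is *)
(* free: it brings the number of swaps up to [n * m].                         *)
Definition test_circuit (W S : seq (qubit n m * qubit n m)) : circuit n m :=
  swap_gates W ++ Hadamard :: ctrlU_gates ++ rcons (swap_gates (rev S)) Hadamard.

(** Matrix factors stand in reverse order of application, so [rev S] in the circuit yields the
    product over [S] itself, to the left of [tensor U]. *)
Lemma circuit_mx_test W S :
  circuit_mx U (test_circuit W S) =
  (hadamard_mx C *t 1%:M)
    *m controlled (qperm_mx C (\prod_(pq <- S) tperm pq.1 pq.2)%g *m tensor U)
    *m (hadamard_mx C *t 1%:M)
    *m controlled (qperm_mx C (\prod_(pq <- rev W) tperm pq.1 pq.2)%g).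
Proof.
rewrite /test_circuit -cats1 -cat1s !circuit_mx_cat !circuit_mx1.
by rewrite !circuit_mx_swaps circuit_mx_ctrlU revK /= -controlledM !mulmxA.
Qed.

Lemma has_gate_counts_test W S :
  (size W + size S = n * m)%N ->
  ((n * m != 1)%N -> all (fun pq => pq.1 != pq.2) (W ++ S)) ->
  has_gate_counts (test_circuit W S).
Proof.
have swaps0 s : hadamards (swap_gates s) = 0%N by elim: s.
have swapsU s : ctrlU_labels (swap_gates s) = [::] by elim: s.
have swapsK s : ctrlSwap_targets (swap_gates s) = s.
  by elim: s => //= -[p q] s ->.
have U0 : hadamards ctrlU_gates = 0%N by rewrite /ctrlU_gates; elim: (enum _).
have UU : ctrlU_labels ctrlU_gates = enum 'I_n.
  by rewrite /ctrlU_gates; elim: (enum _) => //= j s ->.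
have US : ctrlSwap_targets ctrlU_gates = [::].
  by rewrite /ctrlU_gates; elim: (enum _).
have E : ctrlSwap_targets (test_circuit W S) = W ++ rev S.
  rewrite /test_circuit -cats1 /ctrlSwap_targets !pmap_cat /= !pmap_cat /=.
  by rewrite -!/(ctrlSwap_targets _) !swapsK US cats0.
move=> WS neqWS; split.
- rewrite /test_circuit -cats1 /hadamards !count_cat /= !count_cat /=.
  by rewrite -!/(hadamards _) !swaps0 U0.
- rewrite /test_circuit -cats1 /ctrlU_labels !pmap_cat /= !pmap_cat /=.
  by rewrite -!/(ctrlU_labels _) !swapsU UU /= cats0.
- by rewrite E size_cat size_rev.
- by move/neqWS; rewrite E !all_cat all_rev.
Qed.

(** One fixed pair of qubits, repeated [m] times, is enough; two distinct qubits exist once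
    [n * m > 1]. *)
Lemma exists_padding : (0 < n)%N ->
  exists W : seq (qubit n m * qubit n m), size W = m /\
    ((n * m != 1)%N -> all (fun pq => pq.1 != pq.2) W).
Proof.
move=> n0; have [->|m0] := posnP m; first by exists [::].
have cardq : #|{: qubit n m}| = (n * m)%N by rewrite card_prod !card_ord.
(* With a single register qubit only the degenerate swap remains. *)
have [nm1|nm1] := eqVneq (n * m)%N 1%N.
  by exists (nseq m ((Ordinal n0, Ordinal m0), (Ordinal n0, Ordinal m0)));
     rewrite size_nseq.
have: (1 < #|{: qubit n m}|)%N by rewrite cardq ltn_neqAle eq_sym nm1 muln_gt0 n0.
case/card_gt1P=> p [q [_ _ pq]]; exists (nseq m (p, q)); rewrite size_nseq.
by split=> // _; rewrite all_nseq /= pq orbT.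
Qed.

End Circuit.

Arguments test_circuit {n m} W S.

Arguments test_circuit {n m} W S.

Arguments test_circuit {n m} W S.

Theorem theorem2p3 (R : realType) (n m : nat) (hn : (0 < n)%N)
    (U : 'I_n -> 'M[R[i]]_(qdim m))
    (hU : forall j : 'I_n, U j \is unitarymx) :
  exists chi : 'M[R[i]]_(2 * regdim n m),
    [/\ chi \is unitarymx,
        composed_of U chi
      & forall rho : 'I_n -> 'M[R[i]]_(qdim m),
          (forall i : 'I_n, density (rho i)) ->
          \tr ((proj_qubit _ 0 *t 1%:M) *m chi
                 *m (proj_qubit _ 0 *t tensor rho) *m adjmx chi)
          = (1 + 'Re (\tr (\prod_(i < n) (U i *m rho i)))) / 2 ].
Proof.
case: n hn U hU => // n _ U hU.
have [W [sizeW neqW]] := exists_padding n.+1 m isT.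
pose S := shift_swaps n m.
pose V := qperm_mx _ (\prod_(pq <- S) tperm pq.1 pq.2)%g *m tensor U.
have VU : V \is unitarymx.
  by rewrite mul_unitarymx ?qperm_unitary ?tensor_unitary.
exists (circuit_mx U (test_circuit W S)); rewrite circuit_mx_test -/V; split.
- by rewrite !mul_unitarymx ?hadamard_unitary ?controlled_unitary ?qperm_unitary.
- exists (test_circuit W S); rewrite circuit_mx_test; split=> //.
  (* There are now [n + 1] registers: [m] padding swaps and [n * m] swaps for the shift. *)
  apply: has_gate_counts_test; first by rewrite sizeW size_shift_swaps mulSn.
  move=> nm1; rewrite all_cat neqW //=; exact: shift_swaps_neq.
move=> rho rhoD; rewrite hadamard_test_density //.
(* Merging [tensor U] with [tensor rho] leaves the shift applied to the tensor product of the
   [U i *m rho i]. *)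
- rewrite -mulmxA tensorM
    (mxtrace_qperm_shift _ _ _ _ _ (@prod_shift_swaps n m)) //.
- by rewrite adjmx_tensor; apply: eq_tensor => i; case: (rhoD i) => [[<-]].
- by rewrite mxtrace_tensor big1 // => i _; case: (rhoD i).
Qed.
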